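(* Let $\lambda=(\lambda_1,\dots,\lambda_n)$ and $\mu=(\mu_1,\dots,\mu_{n-2})$ be polynomial dominant weights of $GL_n$ and $GL_{n-2}$, respectively, and let $\sigma=\sigma(\lambda,\mu)$ be the sequence $(x_1,z_1,\dots,x_{n-1},z_{n-1})$ obtained by rearranging the sequence $(\lambda_1,\lambda_2,\dots,\lambda_n,\mu_1,\mu_2,\dots,\mu_{n-2})$ in weakly decreasing order, i.e. $x_1\ge z_1\ge\cdots\ge x_{n-1}\ge z_{n-1}$. Then the map from $\mathcal{IP}(\lambda,\mu)$ to $\mathcal{GT}(\sigma)$ sending the interlacing pattern with top row $\lambda=(\lambda_1,\dots,\lambda_n)$, middle row $\kappa=(\kappa_1,\dots,\kappa_{n-1})$ and bottom row $\mu=(\mu_1,\dots,\mu_{n-2})$ to the $(n-1)$-tuple of $GL_2$ Gelfand-Tsetlin patterns whose $i$th member has top row $(x_i,z_i)$ and bottom entry $\kappa_i$, for $1\le i\le n-1$, is a bijection.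
   Context: A polynomial dominant weight of $GL_k=GL_k(\mathbb{C})$ is identified with a sequence $\alpha=(\alpha_1,\dots,\alpha_k)\in\mathbb{Z}^k$ with $\alpha_1\ge\cdots\ge\alpha_k\ge 0$. For polynomial dominant weights $\alpha$ of $GL_k$ and $\beta$ of $GL_{k-1}$, we say $\beta$ interlaces $\alpha$, written $\beta\sqsubseteq\alpha$, if $\alpha_1\ge\beta_1\ge\alpha_2\ge\beta_2\ge\cdots\ge\alpha_{k-1}\ge\beta_{k-1}\ge\alpha_k$. An interlacing pattern with top row $\lambda$ and bottom row $\mu$ is a three-row array with rows $\lambda$, $\kappa$, $\mu$ (from top to bottom), where $\kappa=(\kappa_1,\dots,\kappa_{n-1})$ is an integral sequence with $\mu\sqsubseteq\kappa\sqsubseteq\lambda$; equivalently, with the rows placed in staggered position, the entries are weakly decreasing along the diagonals from left to right. $\mathcal{IP}(\lambda,\mu)$ denotes the set of interlacing patterns whose top and bottom rows are $\lambda$ and $\mu$, respectively. A Gelfand-Tsetlin pattern for $GL_2$ with top row $(x,z)$, where $x\ge z\ge 0$ are integers, is a triangular array with top row $(x,z)$ and one bottom entry $y\in\mathbb{Z}$ satisfying $x\ge y\ge z$. For a sequence $\sigma=(\sigma_1,\dots,\sigma_{2n-2})$ of weakly decreasing nonnegative integers, $\mathcal{GT}(\sigma)$ denotes the set of all $(n-1)$-tuples of Gelfand-Tsetlin patterns for $GL_2$ whose top rows are $(\sigma_{2i-1},\sigma_{2i})$ for $1\le i\le n-1$.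
   Formalization: The formal theorem also assumes that IP(λ,μ) is nonempty; without this the claim fails, e.g. for λ=(0,0,0), μ=(1), where IP is empty but GT(σ) has two elements, and GT(σ) is never empty. *)

(* Defs.v *)
From mathcomp Require Import all_boot all_order all_algebra.
From mathcomp Require Import classical_sets functions.

Set Implicit Arguments.
Unset Strict Implicit.
Unset Printing Implicit Defensive.

Import Order.TTheory GRing.Theory Num.Theory.
Local Open Scope ring_scope.
Local Open Scope classical_set_scope.

(* Sequences are indexed from 0: the entry written alpha_i on paper, for
   1 <= i <= k, is alpha`_i.-1 here. *)

Definition poly_dominant_weight (k : nat) (alpha : k.-tuple int) : Prop :=
  sorted >=%R alpha /\ (forall i : 'I_k, 0 <= tnth alpha i).

(* beta interlaces alpha, for beta of length k - 1 and alpha of length k. *)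
Definition interlaces (k : nat) (beta : k.-1.-tuple int) (alpha : k.-tuple int)
  : Prop :=
  forall i : 'I_k.-1, alpha`_i >= beta`_i /\ beta`_i >= alpha`_i.+1.

Record three_row_array (n : nat) := ThreeRowArray {
  top_row : n.-tuple int;
  middle_row : n.-1.-tuple int;
  bottom_row : n.-2.-tuple int }.

Definition IP (n : nat) (lam : n.-tuple int) (mu : n.-2.-tuple int)
  : set (three_row_array n) :=
  [set p | [/\ top_row p = lam, bottom_row p = mu,
               interlaces (bottom_row p) (middle_row p) &
               interlaces (middle_row p) (top_row p)]].

Record GL2_array := GL2Array {
  GL2_top : int * int;
  GL2_bottom : int }.

Definition is_GL2_pattern (t : GL2_array) : Prop :=
  let: (x, z) := GL2_top t in
  let y := GL2_bottom t in
  [/\ x >= z, z >= 0, x >= y & y >= z].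

(* Meant for a weakly decreasing sequence s of 2 m nonnegative integers. *)
Definition GT (m : nat) (s : seq int) : set (m.-tuple GL2_array) :=
  [set T | forall i : 'I_m,
     is_GL2_pattern (tnth T i) /\
     GL2_top (tnth T i) = (s`_(i.*2), s`_(i.*2.+1))].

Definition sigma (n : nat) (lam : n.-tuple int) (mu : n.-2.-tuple int)
  : seq int :=
  sort >=%R (lam ++ mu).

Lemma size_sigma (n : nat) (lam : n.-tuple int) (mu : n.-2.-tuple int) :
  (2 <= n)%N -> size (sigma lam mu) = n.-1.*2.
Proof.
by case: n lam mu => [|[|n]] // lam mu _;
  rewrite size_sort size_cat !size_tuple -addnn addSnnS.
Qed.

Definition IP_to_GT (n : nat) (p : three_row_array n)
  : n.-1.-tuple GL2_array :=
  let s := sigma (top_row p) (bottom_row p) in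
  [tuple GL2Array (s`_(i.*2), s`_(i.*2.+1)) (tnth (middle_row p) i)
  | i < n.-1].

(* Main.v *)
Require Import Defs.
From mathcomp Require Import all_boot all_order all_algebra.
From mathcomp Require Import classical_sets functions.
From mathcomp Require Import zify.

(** With rows indexed from 0, a middle row kappa fits between lambda and mu
    exactly when
      min(lambda_i, mu_(i-1)) >= kappa_i >= max(lambda_(i+1), mu_i)
    for every i, where mu_(-1) and mu_(n-2) impose no constraint: the
    conditions on different entries of kappa are independent of each other.
    The theorem holds because these bounds, read off as
      lambda_0, max(lambda_1, mu_0), min(lambda_1, mu_0),
                max(lambda_2, mu_1), min(lambda_2, mu_1), ..., lambda_(n-1),
    are the sequence sigma ([sigma_weave]).  They list the entries of lambda
    and mu, each pair (lambda_(i+1), mu_i) being replaced by its maximum and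
    its minimum.  They are weakly decreasing: each maximum is at least the
    minimum that follows it, and a pattern, which exists by assumption, puts an
    entry kappa_i between each lower bound and the upper bound for the same
    place.  So x_i and z_i are the upper and the lower bound for kappa_i, and
    interlacing is the condition that each (x_i, z_i; kappa_i) be a
    Gelfand-Tsetlin pattern. *)

Import Order.TTheory GRing.Theory Num.Theory.

Section Weave.
Local Open Scope ring_scope.

Fixpoint maxmin (l m : seq int) : seq int :=
  match l, m with
  | a :: l', b :: m' => Num.max a b :: Num.min a b :: maxmin l' m'
  | _, _ => l ++ m
  end.

Lemma perm_maxmin (l m : seq int) : perm_eq (maxmin l m) (l ++ m).
Proof.
elim: l m => [|a l IHl] [|b m] //=.
have E : perm_eq [:: Num.max a b, Num.min a b & maxmin l m]
                 [:: a, b & maxmin l m].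
  by case: (leP a b) => _ //; rewrite (perm_catCA [:: b] [:: a]).
apply: (perm_trans E); rewrite perm_cons.
rewrite perm_sym (perm_catCA l [:: b] m) /= perm_cons perm_sym.
exact: IHl.
Qed.

(** The entry of [l] without a partner is compared with the default value 0 of
    [m], which is harmless as it is nonnegative; this gives one formula for all
    indices. *)
Lemma nth_maxmin_even (l m : seq int) (i : nat) :
    size l = (size m).+1 -> (forall j, 0 <= l`_j) ->
  (maxmin l m)`_(i.*2) = Num.max l`_i m`_i.
Proof.
elim: m l i => [|b m IHm] [|a l] //= i [sz] l_ge0.
  have /size0nil-> := sz; case: i => [|i] /=; last by rewrite !nth_nil maxxx.
  by rewrite max_l // (l_ge0 0%N).
by case: i => [|i] //=; apply: IHm => // j; apply: (l_ge0 j.+1).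
Qed.

Lemma nth_maxmin_odd (l m : seq int) (i : nat) :
    size l = (size m).+1 -> (forall j, 0 <= l`_j) ->
  (maxmin l m)`_(i.*2.+1) = Num.min l`_i m`_i.
Proof.
elim: m l i => [|b m IHm] [|a l] //= i [sz] l_ge0.
  have /size0nil-> := sz; case: i => [|i] /=; last by rewrite !nth_nil minxx.
  by rewrite min_r // (l_ge0 0%N).
by case: i => [|i] //=; apply: IHm => // j; apply: (l_ge0 j.+1).
Qed.

(** The bounds imposed on the middle row: the entries at places 2i and 2i+1 are
    the upper and the lower bound for its entry at place i. *)
Definition weave (lam mu : seq int) : seq int :=
  head 0 lam :: maxmin (behead lam) mu.

Section Bounds.
Variables (n : nat) (lam : n.+2.-tuple int) (mu : n.-tuple int).
Hypothesis lam_ge0 : forall j, 0 <= lam`_j.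

Let behead_lam_ge0 j : 0 <= (behead lam)`_j.
Proof. by rewrite nth_behead. Qed.

Let size_behead_lam : size (behead lam) = (size mu).+1.
Proof. by rewrite size_behead !size_tuple. Qed.

Lemma weave_even0 : (weave lam mu)`_0 = lam`_0.
Proof. by rewrite !nth0. Qed.

Lemma weave_evenS (i : nat) :
  (weave lam mu)`_(i.+1.*2) = Num.min lam`_i.+1 mu`_i.
Proof. by rewrite /= nth_maxmin_odd // nth_behead. Qed.

Lemma weave_odd (i : nat) :
  (weave lam mu)`_(i.*2.+1) = Num.max lam`_i.+1 mu`_i.
Proof. by rewrite /= nth_maxmin_even // nth_behead. Qed.

Lemma interlaces_weave (kap : n.+1.-tuple int) :
  interlaces (k := n.+1) mu kap /\ interlaces (k := n.+2) kap lam <->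
  (forall i : 'I_n.+1,
     (weave lam mu)`_(i.*2) >= kap`_i /\ kap`_i >= (weave lam mu)`_(i.*2.+1)).
Proof.
split=> [[mu_kap kap_lam] i|bnd].
  have [lam_i kap_i] := kap_lam i; rewrite weave_odd ge_max kap_i /=.
  split.
    case: i lam_i {kap_i} => -[|i] lti lam_i; first by rewrite weave_even0.
    have lti' : (i < n)%N by [].
    have [_ mu_i] := mu_kap (Ordinal lti').
    by rewrite weave_evenS le_min; apply/andP.
  have [lti|] := ltnP i n; first by have [] := mu_kap (Ordinal lti).
  (* Only the last entry of kap is left: mu has no entry at its place. *)
  by move=> lei; rewrite nth_default ?size_tuple // (le_trans _ kap_i).
split=> i /=.
  have lti := ltn_ord i; have lti' : (i < n.+1)%N by rewrite ltnS ltnW.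
  have [_ +] := bnd (Ordinal lti').
  have [+ _] := bnd (Ordinal (lti : (i.+1 < n.+1)%N)).
  by rewrite weave_evenS weave_odd le_min ge_max => /andP[_ ->] /andP[_ ->].
have [up low] := bnd i; split.
  case: i up {low} => -[|i] lti; first by rewrite weave_even0.
  by rewrite weave_evenS le_min => /andP[].
by move: low; rewrite weave_odd ge_max => /andP[].
Qed.

Lemma perm_weave : perm_eq (weave lam mu) (lam ++ mu).
Proof.
rewrite /weave; case/tupleP: lam => a l /=.
by rewrite perm_cons perm_maxmin.
Qed.

(** Without a pattern the bounds for some entry may be contradictory, and then
    [weave lam mu] is not sorted. *)
Lemma sigma_weave (kap : n.+1.-tuple int) :
    interlaces (k := n.+1) mu kap -> interlaces (k := n.+2) kap lam ->
  sigma (n := n.+2) lam mu = weave lam mu.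
Proof.
move=> mu_kap kap_lam.
have bnd := (interlaces_weave kap).1 (conj mu_kap kap_lam).
have ge_tr : transitive (>=%R : rel int) by move=> y x z /[swap]; apply: le_trans.
have ge_anti : antisymmetric (>=%R : rel int).
  by move=> x y /andP[yx xy]; apply/le_anti/andP.
have ge_total : total (>=%R : rel int) by move=> x y; apply: le_total.
apply: (sorted_eq ge_tr ge_anti); first exact: sort_sorted.
  apply/(sortedP 0) => j ltj.
  have size_w : size (weave lam mu) = n.+1.*2.
    by rewrite (perm_size perm_weave) size_cat !size_tuple -addnn; lia.
  rewrite size_w in ltj.
  have ltj2 : (j./2 < n.+1)%N by lia.
  suff : (weave lam mu)`_j.+1 <= (weave lam mu)`_j by [].
  move: (odd_double_half j); case: (odd j) => <-.
    by rewrite add1n -doubleS weave_evenS weave_odd ge_min le_max lexx.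
  have [up low] := bnd (Ordinal ltj2).
  by rewrite add0n; apply: le_trans low up.
by rewrite perm_sort perm_sym perm_weave.
Qed.

End Bounds.
End Weave.

Lemma nth_poly_dominant_weight_ge0 (k : nat) (alpha : k.-tuple int) (j : nat) :
  poly_dominant_weight alpha -> (0 <= nth 0 alpha j)%R.
Proof.
move=> [_ alpha_ge0].
have [ltj|lej] := ltnP j k; last by rewrite nth_default ?size_tuple.
by have := alpha_ge0 (Ordinal ltj); rewrite (tnth_nth 0%R).
Qed.

Local Open Scope classical_set_scope.

Theorem theorem3p3 (n : nat) (hn : (2 <= n)%N)
    (lam : n.-tuple int) (mu : n.-2.-tuple int)
    (hlam : poly_dominant_weight lam) (hmu : poly_dominant_weight mu)
    (hIP : IP lam mu !=set0) :
  set_bij (IP lam mu) (@GT n.-1 (sigma lam mu)) (@IP_to_GT n).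
Proof.
case: n hn lam mu hlam hmu hIP => [|[|n]] // _ lam mu hlam hmu.
move=> [[lam0 kap0 mu0] [/= -> -> mu_kap kap_lam]].
have lam_ge0 j := nth_poly_dominant_weight_ge0 _ _ j hlam.
have sigmaE := sigma_weave _ _ _ lam_ge0 _ mu_kap kap_lam.
have bounds := interlaces_weave _ _ mu lam_ge0; rewrite -sigmaE in bounds.
split.
- move=> [lam1 kap mu1] [/= -> -> mu_kap1 kap_lam1] i.
  have [up low] := (bounds kap).1 (conj mu_kap1 kap_lam1) i.
  rewrite /IP_to_GT tnth_mktuple /=; split=> //.
  rewrite /is_GL2_pattern /= (tnth_nth 0%R); split=> //.
    exact: le_trans low up.
  by rewrite sigmaE weave_odd // le_max lam_ge0.
- move=> [lam1 kap mu1] [lam2 kap' mu2] /set_mem[/= -> -> _ _].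
  move=> /set_mem[/= -> -> _ _] eqT; congr ThreeRowArray.
  apply: eq_from_tnth => i.
  have := congr1 (fun T => GL2_bottom (tnth T i)) eqT.
  by rewrite /IP_to_GT !tnth_mktuple.
- move=> T GT_T.
  pose kap : n.+1.-tuple int := [tuple GL2_bottom (tnth T i) | i < n.+1].
  have kapE (i : 'I_n.+1) : nth 0%R kap i = GL2_bottom (tnth T i).
    by rewrite -tnth_nth tnth_mktuple.
  have [|mu_kap1 kap_lam1] := (bounds kap).2.
    move=> i; rewrite kapE; have [+ top] := GT_T i.
    by rewrite /is_GL2_pattern top => -[].
  exists (@ThreeRowArray n.+2 lam kap mu) => //.
  apply: eq_from_tnth => i; have [_ top] := GT_T i.
  by rewrite /IP_to_GT tnth_mktuple /= tnth_mktuple -top; case: (tnth T i).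
Qed.
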